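(* Let $G^{\phi}$ be a $3$-regular optimum Hermitian energy mixed graph whose underlying graph $G$ is the complete graph $K_4$. Then, up to isomorphism of mixed graphs and switching equivalence, $G^{\phi}$ is one of $D_1$ and $G_1$; that is, $G^{\phi}$ is isomorphic to a mixed graph that is switching equivalent to $D_1$ or to $G_1$. Here both $D_1$ and $G_1$ have vertex set $\{u_1,u_2,u_3,u_4\}$ and underlying graph $K_4$, where: $D_1$ is the oriented graph with arcs $u_1\to u_2,\ u_1\to u_3,\ u_1\to u_4,\ u_2\to u_3,\ u_3\to u_4,\ u_4\to u_2$; $G_1$ has undirected edges $u_1\leftrightarrow u_2,\ u_1\leftrightarrow u_3,\ u_1\leftrightarrow u_4$ and arcs $u_2\to u_3,\ u_3\to u_4,\ u_4\to u_2$.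
   Context: A mixed graph $G^{\phi}$ is obtained from a finite simple undirected graph $G$ (its underlying graph) by choosing a subset $S\subseteq E(G)$ and giving each edge of $S$ an orientation. Oriented edges are arcs, written $u\to v$, and the edges not in $S$ remain undirected, written $u\leftrightarrow v$. If $S=E(G)$, $G^\phi$ is an oriented graph. Degree, regularity, order, etc. refer to the underlying graph. The Hermitian-adjacency matrix $H(G^\phi)=(h_{kl})$ has $h_{kl}=h_{lk}=1$ if $k\leftrightarrow l$, $h_{kl}=i$ and $h_{lk}=-i$ if $k\to l$, and $h_{kl}=0$ otherwise, where $i$ is the imaginary unit. The Hermitian energy $\mathcal{E}_H(G^\phi)$ is the sum of the absolute values of the eigenvalues of $H(G^\phi)$ (equivalently, the sum of its singular values). A mixed graph on $n$ vertices with maximum degree $\Delta$ is an optimum Hermitian energy mixed graph if $\mathcal{E}_H(G^\phi)=n\sqrt{\Delta}$. Two mixed graphs $G^{\phi_1},G^{\phi_2}$ with the same underlying graph and the same vertex set are switching equivalent if there is a diagonal matrix $D$ with all diagonal entries in $\{1,-1\}$ such that $H(G^{\phi_2})=D^{-1}H(G^{\phi_1})D$. An isomorphism of mixed graphs is a bijection of vertex sets that preserves (in both directions) undirected edges and arcs with their directions. *)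

(* Defs.v *)
From mathcomp Require Import all_boot all_order all_algebra.

Set Implicit Arguments.
Unset Strict Implicit.
Unset Printing Implicit Defensive.

Import Order.TTheory GRing.Theory Num.Theory.
Local Open Scope ring_scope.

(* [adj] is the underlying simple graph; the oriented edges are those related
   by [arc] (in exactly one direction), all other edges are undirected. *)
Record mixed_graph (V : finType) := MixedGraph {
  adj : rel V;
  arc : rel V;
  adj_sym : symmetric adj;
  adj_irr : irreflexive adj;
  arc_adj : forall u v, arc u v -> adj u v;
  arc_asym : forall u v, arc u v -> ~~ arc v u
}.

Section MixedGraph.
Variables (V : finType) (G : mixed_graph V).

Definition undirected (u v : V) : bool :=
  [&& adj G u v, ~~ arc G u v & ~~ arc G v u].

Definition degree (v : V) : nat := #|[set w | adj G v w]|.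

Definition max_degree : nat := \max_(v : V) degree v.

Definition regular (r : nat) : Prop := forall v, degree v = r.

Definition complete_underlying (n : nat) : Prop :=
  #|V| = n /\ forall u v, adj G u v = (u != v).

(* [C] plays the role of the complex numbers. *)
Variable C : numClosedFieldType.

Definition herm_entry (u v : V) : C :=
  if undirected u v then 1
  else if arc G u v then 'i
  else if arc G v u then - 'i
  else 0.

Definition herm_adj : 'M[C]_#|V| :=
  \matrix_(k, l) herm_entry (enum_val k) (enum_val l).

End MixedGraph.

(* The eigenvalues with algebraic multiplicity: the sequence of roots in the
   factorization of the characteristic polynomial into linear factors. *)
Definition eigenvalues (C : numClosedFieldType) (n : nat) (A : 'M[C]_n) :
  seq C := sval (closed_field_poly_normal (char_poly A)).

Definition herm_energy (V : finType) (G : mixed_graph V)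
    (C : numClosedFieldType) : C :=
  \sum_(z <- eigenvalues (herm_adj G C)) `|z|.

Definition optimum_herm_energy (V : finType) (G : mixed_graph V)
    (C : numClosedFieldType) : Prop :=
  herm_energy G C = #|V|%:R * sqrtC (max_degree G)%:R.

Definition switching_equivalent (V : finType) (G1 G2 : mixed_graph V)
    (C : numClosedFieldType) : Prop :=
  adj G1 =2 adj G2 /\
  exists d : 'rV[C]_#|V|,
    (forall k, d 0 k = 1 \/ d 0 k = -1) /\
    herm_adj G2 C = invmx (diag_mx d) *m herm_adj G1 C *m diag_mx d.

Definition isomorphic (V W : finType) (G : mixed_graph V)
    (G' : mixed_graph W) : Prop :=
  exists f : V -> W,
    [/\ bijective f,
        forall u v, undirected G' (f u) (f v) = undirected G u v &
        forall u v, arc G' (f u) (f v) = arc G u v].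

(* In the two graphs below, the ordinals 0, 1, 2, 3 stand for the vertices
   u_1, u_2, u_3, u_4. *)
Definition K4_adj : rel 'I_4 := fun u v => u != v.

Definition D1_arc : rel 'I_4 := fun u v =>
  (val u, val v) \in [:: (0, 1); (0, 2); (0, 3); (1, 2); (2, 3); (3, 1)]%N.

Definition G1_arc : rel 'I_4 := fun u v =>
  (val u, val v) \in [:: (1, 2); (2, 3); (3, 1)]%N.

Lemma K4_adj_sym : symmetric K4_adj.
Proof. by move=> u v; rewrite /K4_adj eq_sym. Qed.

Lemma K4_adj_irr : irreflexive K4_adj.
Proof. by move=> u; rewrite /K4_adj eqxx. Qed.

Lemma D1_arc_adj (u v : 'I_4) : D1_arc u v -> K4_adj u v.
Proof. by case: u v => [[|[|[|[|u]]]] Hu] [[|[|[|[|v]]]] Hv]. Qed.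

Lemma D1_arc_asym (u v : 'I_4) : D1_arc u v -> ~~ D1_arc v u.
Proof. by case: u v => [[|[|[|[|u]]]] Hu] [[|[|[|[|v]]]] Hv]. Qed.

Lemma G1_arc_adj (u v : 'I_4) : G1_arc u v -> K4_adj u v.
Proof. by case: u v => [[|[|[|[|u]]]] Hu] [[|[|[|[|v]]]] Hv]. Qed.

Lemma G1_arc_asym (u v : 'I_4) : G1_arc u v -> ~~ G1_arc v u.
Proof. by case: u v => [[|[|[|[|u]]]] Hu] [[|[|[|[|v]]]] Hv]. Qed.

Definition D1 : mixed_graph 'I_4 :=
  MixedGraph K4_adj_sym K4_adj_irr D1_arc_adj D1_arc_asym.

Definition G1 : mixed_graph 'I_4 :=
  MixedGraph K4_adj_sym K4_adj_irr G1_arc_adj G1_arc_asym.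

(* Main.v *)
(** Summing the squares of the eigenvalues gives [tr H^2 = 12], so the energy
    bound is the equality case of Cauchy-Schwarz: every eigenvalue is [+-sqrt 3]
    and [H^2 = 3I].  Off the diagonal this says that the two walks of length 2
    joining a pair of vertices of [K_4] have opposite weights.  Writing the
    entries of [H] as powers of [i], this is a condition on six exponents in
    [{0, 1, 3}], and the [3^6] cases are checked by computation. *)
Require Import Defs.
From mathcomp Require Import all_boot all_order all_algebra.
From mathcomp Require Import spectral sesquilinear.

Set Implicit Arguments.
Unset Strict Implicit.
Unset Printing Implicit Defensive.

Import Order.TTheory GRing.Theory Num.Theory.
Local Open Scope ring_scope.

(* [path] also defines an [arc]. *)
Local Notation arc := Defs.arc.

(** * Spectra of Hermitian matrices and the equality case *)

Lemma char_poly_conjugate (R : comUnitRingType) n (P A : 'M[R]_n) :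
  P \in unitmx -> char_poly (invmx P *m A *m P) = char_poly A.
Proof.
move=> Pu; pose Q := map_mx polyC P; pose Q' := map_mx polyC (invmx P).
have Q'Q : Q' *m Q = 1%:M by rewrite -map_mxM mulVmx // map_mx1.
rewrite /char_poly /char_poly_mx.
have -> : 'X%:M - map_mx polyC (invmx P *m A *m P)
    = Q' *m ('X%:M - map_mx polyC A) *m Q.
  by rewrite mulmxBr mulmxBl !map_mxM scalar_mxC -(mulmxA _ Q') Q'Q mulmx1.
by rewrite !det_mulmx mulrAC -det_mulmx Q'Q det1 mul1r.
Qed.

(** Unique factorization into monic linear factors: the list chosen by [eigenvalues] can be traded
    for any explicit list of roots. *)
Lemma perm_eigenvalues (C : numClosedFieldType) n (A : 'M[C]_n) (s : seq C) :
  char_poly A = \prod_(z <- s) ('X - z%:P) -> perm_eq (eigenvalues A) s.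
Proof.
move=> As; rewrite /eigenvalues; case: closed_field_poly_normal => r /=.
rewrite (monicP (char_poly_monic A)) scale1r As => /esym rs.
exact: prod_XsubC_eq.
Qed.

Lemma sum_norm_eigenvalues (C : numClosedFieldType) n (A : 'M[C]_n) :
  A \is normalmx ->
  \sum_(z <- eigenvalues A) `|z| = \sum_i `|spectral_diag A 0 i|.
Proof.
move=> /orthomx_spectralP A_eq.
have Ap : char_poly A = \prod_(z <- [seq spectral_diag A 0 i | i : 'I_n])
    ('X - z%:P).
  rewrite {1}A_eq char_poly_conjugate ?unitarymx_unit ?spectral_unitarymx //.
  rewrite char_poly_trig ?diag_mx_is_trig // big_image /=.
  by apply: eq_bigr => i _; rewrite mxE eqxx.
by rewrite (perm_big _ (perm_eigenvalues Ap)) /= big_image.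
Qed.

(* The equality case of Cauchy-Schwarz, via [sum_i (|d_i| - sqrt r)^2 = 0]. *)
Lemma hermitian_sqr_scalar (C : numClosedFieldType) n r (A : 'M[C]_n) :
  A \is hermsymmx -> \tr (A *m A) = n%:R * r%:R ->
  \sum_(z <- eigenvalues A) `|z| = n%:R * sqrtC r%:R -> A *m A = r%:R%:M.
Proof.
move=> Ah trA; have An := hermitian_normalmx Ah.
rewrite (sum_norm_eigenvalues An) => nA.
have /mxOverP d_real := hermitian_spectral_diag_real Ah.
move/orthomx_spectralP: An trA.
set P := spectralmx A; set d := spectral_diag A in nA d_real * => A_eq.
have Pu : P \in unitmx by rewrite unitarymx_unit ?spectral_unitarymx.
have AA : A *m A = invmx P *m (diag_mx d *m diag_mx d) *m P.
  by rewrite {1 2}A_eq !mulmxA mulmxK.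
rewrite AA mxtrace_mulC (mulmxA P) mulmxV // mul1mx mulmx_diag mxtrace_diag => trD.
have d2 i : d 0 i ^+ 2 = r%:R.
  have: \sum_i (`|d 0 i| - sqrtC r%:R) ^+ 2 = 0.
    (* The expansion has three sums: [n * r] from the trace, [- 2 * n * r] from the energy, and
       [n * r] from the constant term. *)
    under eq_bigr => j _ do
      rewrite sqrrB sqrtCK real_normK // -mulrnAr.
    rewrite big_split big_split /= sumrN -mulr_suml nA sumr_const card_ord.
    have -> : \sum_i d 0 i ^+ 2 = n%:R * r%:R.
      by rewrite -trD; apply: eq_bigr => j _; rewrite mxE expr2.
    rewrite -(mulr_natl (r%:R : C) n) -mulrA -(mulr_natr (sqrtC _)).
    rewrite (mulrA (sqrtC _)) -expr2 sqrtCK mulrA (mulr_natr _ 2).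
    by rewrite mulr2n opprD addrA subrr sub0r addNr.
  move/eqP; rewrite psumr_eq0 => [/allP/(_ i (mem_index_enum _))|j _]; last first.
    by rewrite -realEsqr rpredB ?normr_real // ger0_real ?sqrtC_ge0 ?ler0n.
  rewrite /= sqrf_eq0 subr_eq0 => /eqP di.
  by rewrite -(real_normK (d_real 0 i)) di sqrtCK.
rewrite (_ : \row_j _ = const_mx r%:R) ?diag_const_mx; last first.
  by apply/rowP => i; rewrite !mxE -expr2 d2.
by rewrite scalar_mxC mulmxKV.
Qed.

(** This turns equalities between powers of ['i] into congruences mod 4 between exponents. *)
Lemma imaginaryC_prim_root (C : numClosedFieldType) :
  4.-primitive_root ('i : C).
Proof.
have m1 : (-1 == 1 :> C) = false by rewrite eq_sym -addr_eq0 -mulr2n pnatr_eq0.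
apply/andP; split=> //; apply/forallP => -[[|[|[|[|m]]]] lt_m] //=;
  rewrite unity_rootE ?expr1.
- by apply/eqP/negbTE/eqP => i1; move: m1; rewrite -sqrCi i1 expr1n eqxx.
- by rewrite sqrCi m1.
- rewrite exprS sqrCi mulrN1; apply/eqP/negbTE/eqP => i1.
  by move: m1; rewrite -sqrCi -sqrrN i1 expr1n eqxx.
- by rewrite (exprM _ 2 2) sqrCi sqrrN expr1n !eqxx.
Qed.

(** * Hermitian entries as powers of ['i] *)

Section Code.
Variables (V : finType) (G : mixed_graph V) (C : numClosedFieldType).

(* The exponent of ['i] in the Hermitian entry of an edge. *)
Definition edge_code (u v : V) : nat :=
  if arc G u v then 1 else if arc G v u then 3 else 0.

(** Reversing an edge conjugates its entry, hence negates the exponent mod 4; the outer [%% 4]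
    brings 4 back to 0. *)
Lemma edge_codeC u v : edge_code v u = ((4 - edge_code u v) %% 4)%N.
Proof.
rewrite /edge_code; case uv: (arc G u v); last by case: ifP.
by rewrite (negbTE (arc_asym uv)).
Qed.

Lemma edge_code_id u : edge_code u u = 0%N.
Proof.
rewrite /edge_code; case uu: (arc G u u) => //.
by have := arc_adj uu; rewrite adj_irr.
Qed.

Lemma edge_code_mem u v : edge_code u v \in [:: 0; 1; 3]%N.
Proof. by rewrite /edge_code; case: ifP => // _; case: ifP. Qed.

Lemma herm_entryE u v :
  herm_entry G C u v = if adj G u v then 'i ^+ edge_code u v else 0.
Proof.
rewrite /herm_entry /undirected /edge_code.
case uv: (arc G u v); first by rewrite (arc_adj uv) expr1.
case vu: (arc G v u).
  by rewrite adj_sym (arc_adj vu) exprS sqrCi mulrN1.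
by rewrite !andbT.
Qed.

Lemma herm_entryC u v : herm_entry G C v u = (herm_entry G C u v)^*.
Proof.
rewrite !herm_entryE adj_sym; case: ifP => _; last by rewrite conjC0.
rewrite edge_codeC rmorphXn /= conjCi.
have := edge_code_mem u v; rewrite !inE => /or3P[]/eqP-> //=.
  by rewrite expr1 exprS sqrCi mulrN1.
by rewrite expr1 exprS sqrrN sqrCi mulrN1 opprK.
Qed.

Lemma herm_adj_hermsymmx : herm_adj G C \is hermsymmx.
Proof.
apply/is_hermitianmxP; rewrite expr0 scale1r; apply/matrixP => k l.
by rewrite !mxE herm_entryC.
Qed.

Lemma herm_entry_mulC u v :
  herm_entry G C u v * herm_entry G C v u = (adj G u v)%:R.
Proof.
rewrite (herm_entryC u v) -normCK herm_entryE.
by case: ifP => _; rewrite ?normrX ?normCi ?expr1n ?normr0 ?expr0n.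
Qed.

Lemma herm_adj_sqrE k l : (herm_adj G C *m herm_adj G C) k l =
  \sum_w herm_entry G C (enum_val k) w * herm_entry G C w (enum_val l).
Proof.
rewrite mxE (reindex _ (onW_bij _ (@enum_val_bij V))) /=.
by apply: eq_bigr => j _; rewrite !mxE.
Qed.

Lemma tr_herm_adj_sqr :
  \tr (herm_adj G C *m herm_adj G C) = (\sum_u degree G u)%:R.
Proof.
rewrite natr_sum (reindex _ (onW_bij _ (@enum_val_bij V))).
apply: eq_bigr => k _; rewrite herm_adj_sqrE.
under eq_bigr do rewrite herm_entry_mulC.
rewrite -natr_sum /degree -sum1_card; congr _%:R; rewrite [RHS]big_mkcond /=.
by apply: eq_bigr => w _; rewrite inE; case: adj.
Qed.

(** The trace of the square is the degree sum [#|V| * r]. A vertex must exist for the maximum degree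
    to be [r]. *)
Lemma optimum_regular_sqr r : #|V| != 0%N ->
  regular G r -> optimum_herm_energy G C ->
  herm_adj G C *m herm_adj G C = r%:R%:M.
Proof.
move=> V0 Gr Gopt; apply: hermitian_sqr_scalar herm_adj_hermsymmx _ _.
  by rewrite tr_herm_adj_sqr (eq_bigr _ (fun u _ => Gr u)) sum_nat_const natrM.
suff -> : r = max_degree G by [].
have /card_gt0P [u _] : (0 < #|V|)%N by rewrite lt0n.
apply/eqP; rewrite eqn_leq -{1}(Gr u) leq_bigmax /=.
by apply/bigmax_leqP => v _; rewrite Gr.
Qed.

(** The four vertices exhaust [V], and the zero diagonal leaves only the walks through [y] and [z]
    in the entry of the square at [w], [x]. Their weights sum to 0, and the sign is absorbed as
    [-1 = 'i ^+ 2]. *)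
Lemma orthogonal_codes r w x y z : complete_underlying G 4 ->
  herm_adj G C *m herm_adj G C = r%:M -> uniq [:: w; x; y; z] ->
  (edge_code w y + edge_code y x = edge_code w z + edge_code z x + 2 %[mod 4])%N.
Proof.
move=> [V4 Gadj] HH wxyz.
have [] := uniq_min_size wxyz (fun v _ => mem_enum V v).
  by rewrite -cardE V4.
move=> _ full.
have Vwxyz : perm_eq (index_enum V) [:: w; x; y; z].
  apply: uniq_perm (index_enum_uniq V) wxyz _ => v.
  by rewrite full mem_enum mem_index_enum.
have := herm_adj_sqrE (enum_rank w) (enum_rank x).
move: wxyz; rewrite /= !inE !negb_or !andbT.
case/and3P=> /and3P[wx wy wz] /andP[xy xz] yz.
rewrite HH mxE (inj_eq enum_rank_inj) (negPf wx) !enum_rankK (perm_big _ Vwxyz).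
rewrite /= !big_cons big_nil addr0 !herm_entryE !Gadj !eqxx wy wz.
rewrite (eq_sym y) (eq_sym z) xy xz mul0r mulr0 !add0r -!exprD => /esym/eqP.
rewrite addr_eq0 -mulN1r -sqrCi -exprD.
by rewrite (eq_prim_root_expr (imaginaryC_prim_root C)) (addnC 2) => /eqP.
Qed.

End Code.

(** * Relabelling and switching *)

Definition pullback (V W : finType) (f : W -> V) (G : mixed_graph V) :
  mixed_graph W.
refine (@MixedGraph W (relpre f (adj G)) (relpre f (arc G)) _ _ _ _).
- by move=> u v; apply: adj_sym.
- by move=> u; apply: adj_irr.
- by move=> u v; apply: arc_adj.
- by move=> u v; apply: arc_asym.
Defined.

Lemma pullback_isomorphic (V W : finType) (f : W -> V) (G : mixed_graph V) :
  bijective f -> isomorphic G (pullback f G).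
Proof.
case=> g fK gK; exists g; split=> [|u v|u v]; first by exists f.
  by rewrite /undirected /= !gK.
by rewrite /= !gK.
Qed.

(** The diagonal matrix of the signs [(-1) ^+ s u] is its own inverse, so switching multiplies an
    entry by [(-1) ^+ (s u + s v)], a power of ['i] with doubled exponent. *)
Lemma switching_codes (C : numClosedFieldType) (V : finType)
    (G H : mixed_graph V) (s : V -> nat) :
  adj G =2 adj H ->
  (forall u v, adj G u v ->
    edge_code H u v = edge_code G u v + (s u + s v).*2 %[mod 4])%N ->
  switching_equivalent G H C.
Proof.
move=> GH sGH; split=> //.
pose d : 'rV[C]_#|V| := \row_k (-1) ^+ s (enum_val k).
have dd : diag_mx d *m diag_mx d = 1%:M.
  rewrite mulmx_diag -diag_const_mx; congr diag_mx; apply/rowP => k.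
  by rewrite !mxE -expr2 sqrr_sign.
have [du _] := mulmx1_unit dd.
exists d; split=> [k|].
  by rewrite mxE -signr_odd; case: odd; [right | left].
rewrite -(mulmx1 (invmx _)) -dd mulKmx //.
apply/matrixP => k l; rewrite mul_mx_diag mul_diag_mx !mxE !herm_entryE -GH.
case: ifP => [kl|_]; last by rewrite mulr0 mul0r.
have := sGH _ _ kl; move/eqP.
rewrite -(eq_prim_root_expr (imaginaryC_prim_root C)) => /eqP ->.
by rewrite exprD -mul2n exprM sqrCi exprD mulrCA mulrA.
Qed.

(** * The finite check on exponent matrices *)

Local Open Scope nat_scope.

(** The arguments fill the upper triangle row by row, and [o] gives the exponents of the conjugates.
    The diagonal 0 matches [edge_code_id]; it is not an exponent of the zero diagonal of the
    Hermitian matrix. *)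
Definition code_matrix (a b c d e f : nat) : seq (seq nat) :=
  let o x := (4 - x) %% 4 in
  [:: [:: 0; a; b; c]; [:: o a; 0; d; e]; [:: o b; o d; 0; f];
      [:: o c; o e; o f; 0]].

Definition entry (M : seq (seq nat)) i j := nth 0 (nth [::] M i) j.

Definition S4 : seq (seq nat) := permutations (iota 0 4).

Lemma nth_S4_lt p (i : 'I_4) : p \in S4 -> nth 0 p i < 4.
Proof.
rewrite mem_permutations => p_perm.
suff: nth 0 p i \in iota 0 4 by rewrite mem_iota.
by rewrite -(perm_mem p_perm) mem_nth // (perm_size p_perm).
Qed.

Definition orthogonal_rows (M : seq (seq nat)) : bool :=
  all (fun p => let: (w, x, y, z) :=
                  (nth 0 p 0, nth 0 p 1, nth 0 p 2, nth 0 p 3) in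
    entry M w y + entry M y x == entry M w z + entry M z x + 2 %[mod 4]) S4.

(** The hypothesis of [switching_codes] after [M] is relabelled by [p]; diagonal pairs are exempt
    because they are not edges. *)
Definition switches (N M : seq (seq nat)) (p s : seq nat) : bool :=
  all (fun i => all (fun j => (i == j) ||
    (entry N i j == entry M (nth 0 p i) (nth 0 p j) +
                    (nth 0 s i + nth 0 s j).*2 %[mod 4]))
    (iota 0 4)) (iota 0 4).

(* Only [s] up to global negation matters, so [s_0 = 0]. *)
Definition signs : seq (seq nat) :=
  [:: [:: 0; 0; 0; 0]; [:: 0; 0; 0; 1]; [:: 0; 0; 1; 0]; [:: 0; 0; 1; 1];
      [:: 0; 1; 0; 0]; [:: 0; 1; 0; 1]; [:: 0; 1; 1; 0]; [:: 0; 1; 1; 1]].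

(** The 3 stands at the pair 1, 3, whose arc runs backwards, from 3 to 1; likewise in [G1_codes]. *)
Definition D1_codes := code_matrix 1 1 1 1 3 1.
Definition G1_codes := code_matrix 0 0 0 1 3 1.

Definition switches_to_D1_or_G1 (M : seq (seq nat)) : bool :=
  has (fun p => has (fun s => switches D1_codes M p s || switches G1_codes M p s)
    signs) S4.

Lemma orthogonal_switches (a b c d e f : nat) :
    {subset [:: a; b; c; d; e; f] <= [:: 0; 1; 3]} ->
  orthogonal_rows (code_matrix a b c d e f) ->
  switches_to_D1_or_G1 (code_matrix a b c d e f).
Proof.
move=> sub; apply/implyP.
(* Quantifying over lists makes the claim a closed boolean, so it can be evaluated. *)
have: all (fun a => all (fun b => all (fun c => all (fun d => all (fun e =>
        all (fun f => orthogonal_rows (code_matrix a b c d e f) ==>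
                      switches_to_D1_or_G1 (code_matrix a b c d e f))
    [:: 0; 1; 3]) [:: 0; 1; 3]) [:: 0; 1; 3]) [:: 0; 1; 3]) [:: 0; 1; 3])
    [:: 0; 1; 3].
  by vm_compute.
have mem k : k < 6 -> nth 0 [:: a; b; c; d; e; f] k \in [:: 0; 1; 3].
  by move=> lt_k; apply/sub/mem_nth.
move=> /allP/(_ _ (mem 0 isT))/allP/(_ _ (mem 1 isT))/allP/(_ _ (mem 2 isT)).
by move=> /allP/(_ _ (mem 3 isT))/allP/(_ _ (mem 4 isT))/allP/(_ _ (mem 5 isT)).
Qed.

(** * From the graph to its exponent matrix and back *)

Definition graph_codes (V : finType) (G : mixed_graph V) (v : nat -> V) :=
  let c i j := edge_code G (v i) (v j) in
  code_matrix (c 0 1) (c 0 2) (c 0 3) (c 1 2) (c 1 3) (c 2 3).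

Lemma entry_graph_codes (V : finType) (G : mixed_graph V) (v : nat -> V) i j :
  i < 4 -> j < 4 -> entry (graph_codes G v) i j = edge_code G (v i) (v j).
Proof.
by case: i => [|[|[|[|i]]]] // _; case: j => [|[|[|[|j]]]] // _;
  rewrite ?edge_code_id // [RHS]edge_codeC.
Qed.

Lemma entry_D1_codes (u v : 'I_4) : entry D1_codes u v = edge_code D1 u v.
Proof.
by case: u v => [[|[|[|[|u]]]] Hu] [[|[|[|[|v]]]] Hv].
Qed.

Lemma entry_G1_codes (u v : 'I_4) : entry G1_codes u v = edge_code G1 u v.
Proof.
by case: u v => [[|[|[|[|u]]]] Hu] [[|[|[|[|v]]]] Hv].
Qed.

(** Each permutation in [S4] lists four distinct vertices through [v], and [orthogonal_codes]
    applies to them. *)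
Lemma orthogonal_graph_codes (C : numClosedFieldType) (V : finType)
    (G : mixed_graph V) (v : nat -> V) (r : C) :
  complete_underlying G 4 -> {in gtn 4 &, injective v} ->
  (herm_adj G C *m herm_adj G C = r%:M)%R -> orthogonal_rows (graph_codes G v).
Proof.
move=> GK v_inj HH; apply/allP => p; rewrite mem_permutations => p_perm.
have p_lt k : k \in p -> k < 4 by rewrite (perm_mem p_perm) mem_iota.
have vp_uniq : uniq (map v p).
  rewrite map_inj_in_uniq ?(perm_uniq p_perm) ?iota_uniq // => i j pi pj.
  by apply: v_inj; rewrite inE p_lt.
have := perm_size p_perm.
case: p p_perm p_lt vp_uniq => [|w [|x [|y [|z [|? ?]]]]] //= _ p_lt vp_uniq _.
have lt_p k : k \in [:: w; x; y; z] -> k < 4 := p_lt k.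
rewrite !entry_graph_codes ?lt_p ?inE ?eqxx ?orbT //.
exact/eqP/(orthogonal_codes GK HH).
Qed.

Lemma switches_equivalent (C : numClosedFieldType) (V : finType)
    (G : mixed_graph V) (H : mixed_graph 'I_4) (v : nat -> V) N p s :
  p \in S4 -> (forall i j : 'I_4, entry N i j = edge_code H i j) ->
  adj (pullback (fun i : 'I_4 => v (nth 0 p i)) G) =2 adj H ->
  switches N (graph_codes G v) p s ->
  switching_equivalent (pullback (fun i : 'I_4 => v (nth 0 p i)) G) H C.
Proof.
move=> p_S4 NH adjH sw.
apply: (@switching_codes _ _ _ _ (fun i : 'I_4 => nth 0 s i)) => // i j ij.
have lt4 (k : 'I_4) : val k \in iota 0 4 by rewrite mem_iota ltn_ord.
move: (allP (allP sw _ (lt4 i)) _ (lt4 j)); case: eqVneq => [/val_inj eq_ij|_].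
  by move: ij; rewrite eq_ij adj_irr.
by rewrite /= NH entry_graph_codes ?nth_S4_lt // => /eqP.
Qed.

Theorem theorem3p1 (C : numClosedFieldType) (V : finType) (G : mixed_graph V)
    (G_reg : regular G 3)
    (G_opt : optimum_herm_energy G C)
    (G_K4 : complete_underlying G 4) :
  exists G' : mixed_graph 'I_4,
    isomorphic G G' /\
    (switching_equivalent G' D1 C \/ switching_equivalent G' G1 C).
Proof.
have [V4 Gadj] := G_K4.
have V0 : #|V| != 0 by rewrite V4.
have HH := optimum_regular_sqr V0 G_reg G_opt.
have /card_gt0P[v0 _] : 0 < #|V| by rewrite V4.
(* The default [v0] is returned only from index 4 on, whence injectivity restricted to [gtn 4]. *)
pose v i := nth v0 (enum V) i.
have v_inj : {in gtn 4 &, injective v}.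
  move=> i j; rewrite !inE => i4 j4 /eqP.
  by rewrite nth_uniq ?enum_uniq -?cardE ?V4 // => /eqP.
have: switches_to_D1_or_G1 (graph_codes G v).
  apply: orthogonal_switches (orthogonal_graph_codes G_K4 v_inj HH).
  by apply/allP; rewrite /= !edge_code_mem.
case/hasP=> p p_S4 /hasP[s _ sw].
(* The permutation found by the check becomes the isomorphism, and [s] gives the switching signs. *)
pose h (i : 'I_4) := v (nth 0 p i).
have h_inj : injective h.
  have p_perm : perm_eq p (iota 0 4) by rewrite -mem_permutations.
  move=> i j /v_inj; rewrite !inE !nth_S4_lt // => /(_ isT isT)/eqP.
  rewrite nth_uniq ?(perm_size p_perm) ?(perm_uniq p_perm) ?iota_uniq //.
  by move/eqP/val_inj.
have h_adj i j : adj G (h i) (h j) = (i != j) by rewrite Gadj (inj_eq h_inj).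
exists (pullback h G); split.
  by apply/pullback_isomorphic/inj_card_bij; rewrite // card_ord V4.
case/orP: sw => sw; [left | right]; apply: switches_equivalent sw => //.
  exact: entry_D1_codes.
exact: entry_G1_codes.
Qed.
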